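(* Let $k$ be a positive integer and suppose that for infinitely many primes $p$, every nice subset of $\mathbb{Z}_p$ of size $k$ admits an Alspach ordering. Then there exists a positive integer $N(k)$ such that for every abelian group $G$ with $\vartheta(G)>N(k)$, every nice subset of $G$ of size $k$ admits an Alspach ordering.
   Context: A finite subset $A$ of an abelian group $G$ is called nice if $0_G\notin A$ and $\sum_{z\in A} z\neq 0_G$. For a finite subset $A=\{x_1,\dots,x_k\}$ of $G$ and an ordering $\omega=(x_{j_1},\dots,x_{j_k})$ of its elements, the partial sums are $s_i(\omega)=x_{j_1}+\dots+x_{j_i}$ for $i=1,\dots,k$. An ordering $\omega$ of $A$ is called an Alspach ordering if $s_i(\omega)\neq 0_G$ for all $i$ and $s_i(\omega)\neq s_j(\omega)$ for all $1\le i<j\le k$. For $g\in G$, $o(g)$ denotes the cardinality (possibly infinite) of the cyclic subgroup $\langle g\rangle$, and $\vartheta(G)=\min_{0_G\neq g\in G} o(g)$. *)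

(* Defs.v *)
From HB Require Import structures.
From mathcomp Require Import all_boot all_order all_algebra finmap.
From mathcomp Require Import all_classical constructive_ereal.

Set Implicit Arguments.
Unset Strict Implicit.
Unset Printing Implicit Defensive.

Import Order.TTheory GRing.Theory Num.Theory.
Local Open Scope classical_set_scope.
Local Open Scope ring_scope.

Definition nice (G : zmodType) (A : {fset G}) : Prop :=
  0 \notin A /\ \sum_(z <- A) z != 0.

Definition ordering (G : zmodType) (A : {fset G}) (w : seq G) : Prop :=
  perm_eq w A.

Definition partial_sum (G : zmodType) (w : seq G) (i : nat) : G :=
  \sum_(x <- take i w) x.

Definition Alspach_ordering (G : zmodType) (A : {fset G}) (w : seq G) : Prop :=
  [/\ ordering A w,
      forall i : nat, (1 <= i <= #|` A|)%N -> partial_sum w i != 0 &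
      forall i j : nat, (1 <= i)%N -> (i < j)%N -> (j <= #|` A|)%N ->
        partial_sum w i != partial_sum w j].

Definition cyclic_subgroup (G : zmodType) (g : G) : set G :=
  range (fun m : int => g *~ m).

(* \bar int only serves as a totally ordered type containing the natural
   numbers and an infinite element +oo. *)
Definition ord_elt (G : zmodType) (g : G) : \bar int :=
  if `[< finite_set (cyclic_subgroup g) >]
  then (#|` fset_set (cyclic_subgroup g)|%:Z)%:E else +oo%E.

(* The minimum of S; the default value +oo is only taken when S has no minimum,
   which for vartheta happens exactly when G is the trivial group. *)
Definition minimum (S : set (\bar int)) : \bar int :=
  xget +oo%E (S `&` lbound S).

Definition vartheta (G : zmodType) : \bar int :=
  minimum [set ord_elt g | g in [set g : G | g != 0]].

(* Main.v *)
(** The vanishing of the partial sums of [A = {x_1, ..., x_k}] and of their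
    differences concerns only the finitely many integer linear forms with
    coefficients in [{-1, 0, 1}].  Let [T] be the set of those forms that vanish
    at [x].  If another form [w] vanished on all rational solutions of [T], then
    [d w] would be an integer combination of [T] for some [d > 0], so that [w x]
    would be a nonzero element of [G] of order at most [d]; this is excluded as
    soon as [vartheta G] exceeds all the numbers [d], which depend only on
    [(T, w)].  Hence there is an integer point [y] at which exactly the forms of
    [T] vanish, and the same holds for its reduction modulo a large prime [p].
    An Alspach ordering of the reduction then transfers back to [A]. *)
Require Import Defs.
From mathcomp Require Import all_boot all_order all_algebra finmap.
From mathcomp Require Import all_classical constructive_ereal.

Set Implicit Arguments.
Unset Strict Implicit.
Unset Printing Implicit Defensive.

Import Order.TTheory GRing.Theory Num.Theory.
Local Open Scope ring_scope.

(** The group is arbitrary, so that one coefficient vector can be evaluated at elements of [G], at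
    integer points and at their residues modulo [p]. *)
Definition int_form (k : nat) (G : zmodType) (a : 'I_k -> int) (x : 'I_k -> G) : G :=
  \sum_i x i *~ a i.

Section IntForms.
Variable k : nat.
Implicit Types (G : zmodType) (a : 'I_k -> int).

Lemma int_formMz_coef G (m : int) a (x : 'I_k -> G) :
  int_form (fun i => m * a i) x = int_form a x *~ m.
Proof.
by rewrite mulrz_suml; apply: eq_bigr => i _; rewrite -mulrzA mulrC.
Qed.

Lemma int_form_sum_coef G (F : finType) (P : pred F) (c : F -> 'I_k -> int)
    (x : 'I_k -> G) :
  int_form (fun i => \sum_(v | P v) c v i) x = \sum_(v | P v) int_form (c v) x.
Proof.
by rewrite exchange_big; apply: eq_bigr => i _; rewrite mulrz_sumr.
Qed.

Lemma int_formMzD a (m : int) (y z : 'I_k -> int) :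
  int_form a (fun i => m * y i + z i) = m * int_form a y + int_form a z.
Proof.
rewrite mulr_sumr -big_split; apply: eq_bigr => i _ /=.
by rewrite !mulrzz mulrDl mulrA.
Qed.

Lemma int_form_intr (R : pzRingType) a (y : 'I_k -> int) :
  int_form a (fun i => (y i)%:~R : R) = (int_form a y)%:~R.
Proof.
by rewrite rmorph_sum; apply: eq_bigr => i _; rewrite /= mulrzz intrM mulrzr.
Qed.

End IntForms.

Lemma common_denominator (F : finType) (q : F -> rat) :
  exists (d : nat) (n : F -> int), (0 < d)%N /\ forall v, (n v)%:~R = d%:R * q v.
Proof.
have D0 : 0 < \prod_v denq (q v) by apply: prodr_gt0 => v _; apply: denq_gt0.
exists (absz (\prod_v denq (q v))).
exists (fun v => numq (q v) * \prod_(u | u != v) denq (q u)).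
split=> [|v]; first by rewrite absz_gt0 gt_eqF.
rewrite (pmulrn 1 (absz _)) gtz0_abs // [in RHS](bigD1 v) //= !intrM numqE.
by rewrite [RHS]mulrC mulrA.
Qed.

(** Linear algebra over the rationals: either [b] lies in the row space of [c], or some column of
    the cokernel matrix is killed by all rows of [c] but not by [b]. Clearing denominators makes the
    certificate integral in both cases. *)
Lemma int_form_dependent_or_separated (m k : nat) (c : 'I_m -> 'I_k -> int)
    (b : 'I_k -> int) :
  (exists (d : nat) (n : 'I_m -> int), (0 < d)%N /\
     forall i, d%:Z * b i = \sum_v n v * c v i) \/
  (exists y : 'I_k -> int,
     (forall v, int_form (c v) y = 0) /\ int_form b y != 0).
Proof.
pose M : 'M[rat]_(m, k) := \matrix_(v, i) (c v i)%:~R.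
pose w : 'rV[rat]_k := \row_i (b i)%:~R.
have [/submxP[D wE] | nwM] := boolP (w <= M)%MS.
- have [d [n [d0 nE]]] := common_denominator (D ord0).
  left; exists d, n; split=> // i; apply: (@intr_inj rat).
  have := congr1 (fun A : 'rV[rat]_k => d%:R * A ord0 i) wE.
  rewrite !mxE intrM => ->; rewrite mulr_sumr rmorph_sum; apply: eq_bigr => v _.
  by rewrite /= intrM nE mxE mulrA.
- have [j wj] : exists j, (w *m cokermx M) ord0 j != 0.
    apply/existsP; apply: contraNT nwM; rewrite negb_exists => /forallP wM0.
    rewrite submxE; apply/eqP/rowP => j; rewrite [RHS]mxE.
    by apply/eqP; move: (wM0 j); rewrite negbK.
  have [d [y [d0 yE]]] := common_denominator (fun i => cokermx M i j).
  have formE a : (int_form a y)%:~R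
      = d%:R * ((\row_i (a i)%:~R) *m cokermx M) ord0 j.
    rewrite mxE mulr_sumr rmorph_sum; apply: eq_bigr => i _.
    by rewrite /= mulrzz intrM yE mxE mulrC mulrCA.
  right; exists y; split=> [v|].
  + apply: (@intr_inj rat); rewrite formE.
    have -> : \row_i (c v i)%:~R = row v M by apply/rowP => i; rewrite !mxE.
    by rewrite -row_mul mulmx_coker !mxE mulr0.
  + by rewrite -(intr_eq0 rat) formE mulf_neq0 // pnatr_eq0 -lt0n.
Qed.

(** By induction on [W]: a point [y] good for the tail but killed by the new form is replaced by
    [m * y + z], where [z] handles the new form and [m] is large. *)
Lemma int_form_avoidance (k : nat) (F : eqType) (c : F -> 'I_k -> int)
    (K : ('I_k -> int) -> Prop) (W : seq F) :
  (forall m y z, K y -> K z -> K (fun i => m * y i + z i)) ->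
  K (fun=> 0) ->
  (forall w, w \in W -> exists2 y, K y & int_form (c w) y != 0) ->
  exists2 y, K y & forall w, w \in W -> int_form (c w) y != 0.
Proof.
move=> KD K0; elim: W => [|w W IHW] sepW; first by exists (fun=> 0).
have [y Ky yW] : exists2 y, K y & forall w, w \in W -> int_form (c w) y != 0.
  by apply: IHW => v vW; apply: sepW; rewrite inE vW orbT.
have [yw0|yw] := eqVneq (int_form (c w) y) 0; last first.
  by exists y => // v; rewrite inE => /predU1P[-> //|/yW].
have [z Kz zw] := sepW w (mem_head _ _).
(* Since [int_form (c v) y] is a nonzero integer, [m] times it exceeds [int_form (c v) z] in
   absolute value, so the two cannot cancel. *)
pose m : int := \sum_(v <- W) `|int_form (c v) z| + 1.
exists (fun i => m * y i + z i); first exact: KD.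
move=> v; rewrite int_formMzD inE => /predU1P[->|vW].
  by rewrite yw0 mulr0 add0r.
have zm : `|int_form (c v) z| < m.
  rewrite ltzD1 (big_rem v) //= lerDl; apply: sumr_ge0 => u _.
  exact: normr_ge0.
apply: contraTneq zm => /eqP; rewrite addr_eq0 => /eqP myz.
rewrite -normrN -myz normrM -leNgt.
have m0 : 0 <= m by rewrite addr_ge0 // sumr_ge0.
by rewrite (ger0_norm m0) ler_peMr // -gtz0_ge1 normr_gt0 yW.
Qed.

Lemma int_form_model (k : nat) (F : finType) (c : F -> 'I_k -> int) :
  exists N : nat, forall G : zmodType,
    (forall (g : G) d, (0 < d <= N)%N -> g *+ d = 0 -> g = 0) ->
    forall x : 'I_k -> G, exists y : 'I_k -> int,
      forall v, (int_form (c v) y == 0) = (int_form (c v) x == 0).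
Proof.
pose rel (T : {set F}) w d := (0 < d)%N /\ exists n : 'I_#|T| -> int,
  forall i, d%:Z * c w i = \sum_v n v * c (enum_val v) i.
(* The bound has to be fixed before [G] and [x], hence a multiplier is chosen for every pair
   [(T, w)]; the value 0 stands for pairs without a relation. *)
have /choice[D DP] : forall Tw : {set F} * F,
    exists e, forall d, rel Tw.1 Tw.2 d -> rel Tw.1 Tw.2 e.
  move=> Tw; have [[d rd]|nrel] := pselect (exists d, rel Tw.1 Tw.2 d).
    by exists d.
  by exists 0%N => d rd; case: nrel; exists d.
exists (\max_Tw D Tw) => G tfG x.
pose T := [set v | int_form (c v) x == 0]%SET.
have [||v vT|y yT yW] := @int_form_avoidance k F c
    (fun y => forall v, v \in T -> int_form (c v) y = 0) (enum (~: T)%SET).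
- by move=> m y z yT zT v vT; rewrite int_formMzD yT // zT // mulr0 addr0.
- by move=> v _; apply: big1 => i _; rewrite mul0rz.
- have [[d [n [d0 nE]]]|[y [y0 yv]]] :=
      int_form_dependent_or_separated (fun u : 'I_#|T| => c (enum_val u)) (c v).
    have /DP[/= D0 [n' n'E]] : rel (T, v).1 (T, v).2 d by split=> //; exists n.
    (* A relation would make [D (T, v)] times the value of form [v] at [x] a combination of values
       that vanish, so that value would itself vanish, against the choice of [v] outside [T]. *)
    move: vT; rewrite mem_enum !inE => /eqP[]; apply: (tfG _ (D (T, v))).
      by rewrite D0 leq_bigmax.
    rewrite pmulrn -int_formMz_coef.
    have -> : int_form (fun i => (D (T, v))%:Z * c v i) x =
        int_form (fun i => \sum_u n' u * c (enum_val u) i) x.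
      by apply: eq_bigr => i _; rewrite n'E.
    rewrite int_form_sum_coef big1 // => u _; rewrite int_formMz_coef.
    have := enum_valP u; rewrite inE => /eqP ->; exact: mul0rz.
  by exists y => // u uT; rewrite -(enum_rankK_in uT uT) y0.
- exists y => v; have [vT|vT] := boolP (v \in T).
    by rewrite yT // eqxx; move: vT; rewrite inE => ->.
  have /yW/negbTE -> : v \in enum (~: T)%SET by rewrite mem_enum inE.
  by move: vT; rewrite inE => /negbTE ->.
Qed.

(** The two sets may overlap, so equality of any two subset sums is the vanishing of a single
    form. *)
Definition sign_coef (k : nat) (PQ : {set 'I_k} * {set 'I_k}) (i : 'I_k) : int :=
  (i \in PQ.1)%:Z - (i \in PQ.2)%:Z.

Lemma int_form_sign_coef (k : nat) (G : zmodType) (P Q : {set 'I_k})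
    (x : 'I_k -> G) :
  int_form (sign_coef (P, Q)) x = \sum_(i in P) x i - \sum_(i in Q) x i.
Proof.
rewrite (big_mkcond (mem P)) (big_mkcond (mem Q)) -sumrB; apply: eq_bigr => i _.
by rewrite mulrzBr /=; do 2!case: (_ \in _).
Qed.

Lemma partial_sum_map (k : nat) (G : zmodType) (x : 'I_k -> G) (s : seq 'I_k)
    (n : nat) :
  uniq s -> partial_sum (map x s) n = \sum_(i in [set i in take n s]%SET) x i.
Proof.
move=> us; rewrite /partial_sum -map_take big_map big_uniq ?take_uniq //=.
by apply: eq_bigl => i; rewrite inE.
Qed.

Lemma intr_Zp_eq0 (p : nat) (n : int) :
  prime p -> ((n%:~R : 'Z_p) == 0) = (p %| absz n)%N.
Proof.
move=> pp; have chp : p \in [pchar 'Z_p].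
  by rewrite inE pp pchar_Zp ?prime_gt1 //=.
rewrite (dvdn_pcharf chp); case: n => n //=.
by rewrite NegzE mulrNz oppr_eq0.
Qed.

(** Division with remainder by [d] reduces every multiple of [g] to one of the first [d];
    repetitions may occur, hence only an inequality. *)
Lemma ord_elt_torsion (G : zmodType) (g : G) (d : nat) :
  (0 < d)%N -> g *+ d = 0 -> exists2 n : nat, ord_elt g = (n%:Z)%:E & (n <= d)%N.
Proof.
move=> d0 gd0; pose C := [fset g *+ val i | i in 'I_d]%fset.
have CE : cyclic_subgroup g = [set` C]%classic.
  apply/seteqP; split=> h /=.
    case=> m _ <-; have dz : d%:Z != 0 by rewrite eqz_nat -lt0n.
    have mod0 := modz_ge0 m dz; have modd := ltz_mod m dz.
    apply/imfsetP.
    have lt : (absz (m %% d)%Z < d)%N by rewrite -ltz_nat gez0_abs.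
    exists (Ordinal lt) => //=; rewrite pmulrn gez0_abs //.
    by rewrite {1}(divz_eq m d) mulrzDr mulrC mulrzA -pmulrn gd0 mul0rz add0r.
  by move=> /imfsetP[i _ ->]; exists (i : int).
have finC : finite_set (cyclic_subgroup g) by rewrite CE; exact: finite_fset.
rewrite /ord_elt asboolT //; eexists; first by [].
rewrite CE set_fsetK; apply: (leq_trans (leq_imfset_card _ _ _)).
by rewrite -cardE card_ord.
Qed.

Lemma lt_vartheta_torsion (G : zmodType) (N : nat) :
  ((N%:Z)%:E < vartheta G)%E ->
  forall (g : G) d, (0 < d <= N)%N -> g *+ d = 0 -> g = 0.
Proof.
move=> Nlt g d /andP[d0 dN] gd0; apply/eqP; apply: contraLR Nlt => g0.
rewrite -leNgt.
have [n gE nd] := ord_elt_torsion d0 gd0.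
rewrite /vartheta /minimum; set S := (X in (X `&` _)%classic).
have Sn : S (n%:Z)%:E by exists g.
have exS : exists n : nat, `[< S (n%:Z)%:E >] by exists n; apply/asboolP.
(* The least natural number in [S] is a minimum of [S], all other values being natural numbers or
   [+oo]; this excludes the default of [xget]. *)
have [m0 /asboolP Sm0 m0min] := ex_minnP exS.
case: xgetP => [m -> [Sm lbm]|/(_ (m0%:Z)%:E)].
  by apply: (le_trans (lbm _ Sn)); rewrite lee_fin lez_nat (leq_trans nd).
case; split=> // _ [h h0 <-].
have hS : S (ord_elt h) by exists h.
move: hS; rewrite /ord_elt; case: ifP => _ hS; last exact: leey.
by rewrite lee_fin lez_nat m0min //; apply/asboolP.
Qed.

Lemma infinite_nat_unbounded (S : set nat) (n : nat) :
  infinite_set S -> exists2 m, S m & (n < m)%N.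
Proof.
move=> infS; apply: contrapT => Sn; apply: infS.
apply: (@sub_finite_set _ _ `I_n.+1); last exact: finite_II.
move=> m Sm /=; rewrite ltnS leqNgt; apply/negP => nm; apply: Sn.
by exists m.
Qed.

Lemma perm_map_lift (I : finType) (V : eqType) (z : I -> V) (w : seq V) :
  injective z -> perm_eq w (map z (enum I)) ->
  exists2 s, perm_eq s (enum I) & w = map z s.
Proof.
move=> zinj wz.
have [s ws] : exists s, w = map z s.
  have : {subset w <= map z (enum I)} by move=> u; rewrite (perm_mem wz).
  elim: w {wz} => [|u w IHw] sub; first by exists [::].
  have /mapP[i _ ->] := sub u (mem_head _ _).
  have [v vw|s ->] := IHw; first by apply: sub; rewrite inE vw orbT.
  by exists (i :: s).
by exists s => //; apply: (perm_map_inj zinj); rewrite -ws.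
Qed.

(** Distinctness, niceness and the Alspach conditions all compare subset sums (singletons, the empty
    set, the full set, prefixes), so they agree for [x] and [z]. *)
Lemma Alspach_ordering_transfer (k : nat) (G H : zmodType)
    (x : 'I_k -> G) (z : 'I_k -> H) (A : {fset G}) :
  (forall P Q : {set 'I_k}, (\sum_(i in P) z i == \sum_(i in Q) z i)
                          = (\sum_(i in P) x i == \sum_(i in Q) x i)) ->
  perm_eq A (map x (enum 'I_k)) -> nice A ->
  (forall B : {fset H}, #|` B|%fset = k -> nice B ->
     exists w, Alspach_ordering B w) ->
  exists w, Alspach_ordering A w.
Proof.
move=> zx Ax [A0 sumA] ordH.
have x0 i : x i != 0.
  apply: contraNneq A0 => <-; rewrite (perm_mem Ax).
  by apply: map_f; rewrite mem_enum.
have xinj : injective x.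
  by apply/injectiveP; have := fset_uniq A; rewrite (perm_uniq Ax).
have zinj : injective z.
  move=> i j zij; apply: xinj; apply/eqP.
  by have := zx [set i]%SET [set j]%SET; rewrite !big_set1 zij eqxx.
have z0 i : z i != 0.
  by have := zx [set i]%SET finset.set0; rewrite !big_set1 !big_set0 => ->.
pose B := [fset z i | i in 'I_k]%fset.
have Bz : perm_eq B (map z (enum 'I_k)).
  apply: uniq_perm => [||u]; first exact: fset_uniq.
    by rewrite (map_inj_uniq zinj) enum_uniq.
  apply/imfsetP/mapP => -[i _ ->]; exists i => //; exact: mem_enum.
have cardA : #|` A|%fset = k by rewrite (perm_size Ax) size_map size_enum_ord.
have cardB : #|` B|%fset = k by rewrite (perm_size Bz) size_map size_enum_ord.
have niceB : nice B.
  split; first by apply/imfsetP => -[i _ /esym/eqP]; rewrite (negbTE (z0 i)).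
  have sumT (V : zmodType) (u : 'I_k -> V) :
    \sum_(i in finset.setT) u i = \sum_i u i by apply: eq_bigl => i; rewrite inE.
  have := zx finset.setT finset.set0; rewrite !sumT !big_set0.
  rewrite (perm_big _ Bz) big_map big_enum => /= ->.
  by move: sumA; rewrite (perm_big _ Ax) big_map big_enum.
have [w [wB w0 wi]] := ordH B cardB niceB.
(* The ordering of [B] comes from an ordering [s] of the indices, which can then be applied to
   [x]. *)
have [s sk ws] := perm_map_lift zinj (perm_trans wB Bz).
have us : uniq s by rewrite (perm_uniq sk) enum_uniq.
rewrite cardB in w0 wi.
exists (map x s); split; rewrite ?cardA.
- by rewrite /ordering perm_sym (perm_trans Ax) // perm_sym perm_map.
- move=> i /w0; rewrite ws !partial_sum_map //.
  by have := zx [set j in take i s]%SET finset.set0; rewrite !big_set0 => ->.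
- move=> i j i1 ij /(wi i j i1 ij).
  by rewrite ws !partial_sum_map // zx.
Qed.

Local Close Scope ring_scope.

Theorem theorem3p1 (k : nat) (hk : (0 < k)%N)
  (hp : infinite_set [set p : nat | prime p /\
          forall A : {fset 'Z_p}, #|` A|%fset = k -> nice A ->
            exists w : seq 'Z_p, Alspach_ordering A w]%classic) :
  exists N : nat, (0 < N)%N /\
    forall G : zmodType, ((N%:Z)%:E < vartheta G)%E ->
      forall A : {fset G}, #|` A|%fset = k -> nice A ->
        exists w : seq G, Alspach_ordering A w.
Proof.
have [N modelN] := int_form_model (@sign_coef k).
(* The successor only ensures positivity. *)
exists N.+1; split=> // G ltG A cardA niceA.
pose x (i : 'I_k) : G := nth 0%R A i.
have Ax : perm_eq A (map x (enum 'I_k)).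
  rewrite (_ : map x _ = A) //.
  rewrite /x (map_comp (nth 0%R A) val) val_enum_ord -cardA; exact: mkseq_nth.
have [|y yx] := modelN G _ x.
  move=> g d /andP[d0 dN]; apply: (lt_vartheta_torsion ltG).
  by rewrite d0 leqW.
(* [M] bounds every form at [y], so a prime above [M] divides such a value only if it is 0. *)
pose M := \sum_v absz (int_form (sign_coef v) y).
have [p [pp ordp] Mp] := infinite_nat_unbounded M hp.
apply: (@Alspach_ordering_transfer k G 'Z_p x (fun i => (y i)%:~R%R)) => //.
move=> P Q; rewrite -2![(_ == \sum_(i in _) _)%R]GRing.subr_eq0.
rewrite -!int_form_sign_coef int_form_intr intr_Zp_eq0 // -yx -absz_eq0.
have [->|n0] := posnP (absz _); first by rewrite dvdn0.
rewrite gtnNdvd ?(gtn_eqF n0) //; apply: leq_ltn_trans Mp.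
by rewrite /M (bigD1 (P, Q)) //= leq_addr.
Qed.
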